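(* Let $S$ be a finite semigroup with a faithful completely reducible representation over a field $K$. Let $V$ be a finite dimensional $KS$-module affording a faithful representation of $S$ and suppose that $V_1,\ldots,V_k$ are the non-null composition factors of $V$. Then $V_1\oplus\cdots\oplus V_k$ affords a faithful representation of $S$.
   Context: A $KS$-module is a $K$-vector space with an action of $S$ by $K$-linear maps (extended linearly to the semigroup algebra $KS$, which need not be unital). A $KS$-module $V$ is simple if $KS\cdot V\ne 0$ and its only submodules are $0$ and $V$; it is semisimple if isomorphic to a direct sum of simple modules (the zero module is semisimple). A completely reducible representation is one afforded by a semisimple module; the degree $0$ representation is allowed. A representation of $S$ is faithful if it is an injective map on $S$. A null module is a one-dimensional module $W$ with $KS\cdot W=0$. A composition series of a $KS$-module is an unrefinable series of submodules; each composition factor is either simple or null. The non-null composition factors are listed with multiplicity. *)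

(* Defs.v *)
From HB Require Import structures.
From mathcomp Require Import all_boot all_order all_algebra.
From mathcomp Require Import boolp classical_sets functions cardinality.

Set Implicit Arguments.
Unset Strict Implicit.
Unset Printing Implicit Defensive.

Import GRing.Theory.
Local Open Scope ring_scope.
Local Open Scope quotient_scope.

#[short(type="finSemigroupType")]
HB.structure Definition FinSemigroup := {S of Finite S & Semigroup S}.

HB.mixin Record Lmodule_isKSModule (K : fieldType) (S : finSemigroupType) V
    of GRing.Lmodule K V := {
  act : S -> V -> V;
  act_is_linear : forall s, linear (act s);
  actM : forall s t v, act (s * t)%g v = act s (act t v)
}.

#[short(type="ksModType")]
HB.structure Definition KSModule (K : fieldType) (S : finSemigroupType) :=
  {V of GRing.Lmodule K V & Lmodule_isKSModule K S V}.

#[short(type="finKSModType")]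
HB.structure Definition FinKSModule (K : fieldType) (S : finSemigroupType) :=
  {V of Vector K V & Lmodule_isKSModule K S V}.

HB.instance Definition _ (K : fieldType) (S : finSemigroupType)
    (V : ksModType K S) (s : S) :=
  GRing.isLinear.Build K V V _ (act s) (act_is_linear s).

HB.mixin Record isActClosed (K : fieldType) (S : finSemigroupType)
    (V : ksModType K S) (A : V -> bool) := {
  act_closed : forall s : S, {in A, forall v, act s v \in A}
}.

#[short(type="ksSubmodule")]
HB.structure Definition KSSubmodule (K : fieldType) (S : finSemigroupType)
    (V : ksModType K S) :=
  {A of GRing.SubmodClosed K A & isActClosed K S V A}.

Fact ksSubmodule_oppr (K : fieldType) (S : finSemigroupType)
  (V : ksModType K S) (A : ksSubmodule V) : oppr_closed A.
Proof. by move=> v vA; rewrite -scaleN1r rpredZ. Qed.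

HB.instance Definition _ (K : fieldType) (S : finSemigroupType)
    (V : ksModType K S) (A : ksSubmodule V) :=
  GRing.isOppClosed.Build V (KSSubmodule.sort A) (@ksSubmodule_oppr K S V A).

Section SubmoduleType.
Variables (K : fieldType) (S : finSemigroupType) (V : ksModType K S).
Variable A : ksSubmodule V.

Record submod_type := SubmodType { submod_val : V; _ : submod_val \in A }.

HB.instance Definition _ := [isSub for submod_val].
HB.instance Definition _ := [Choice of submod_type by <:].
HB.instance Definition _ := [SubChoice_isSubLmodule of submod_type by <:].

Definition submod_act (s : S) (x : submod_type) : submod_type :=
  SubmodType (act_closed s _ (valP x)).

Fact submod_act_is_linear s : linear (submod_act s).
Proof. by move=> a x y; apply: val_inj; rewrite /= linearP. Qed.

Fact submod_actM s t x : submod_act (s * t)%g x = submod_act s (submod_act t x).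
Proof. by apply: val_inj; rewrite /= actM. Qed.

HB.instance Definition _ :=
  Lmodule_isKSModule.Build K S submod_type submod_act_is_linear submod_actM.

End SubmoduleType.

Section QuotientModule.
Variables (K : fieldType) (S : finSemigroupType) (V : ksModType K S).
Variable B : ksSubmodule V.

Definition quotient_mod := Quotient.quot B.
HB.instance Definition _ := GRing.Zmodule.on quotient_mod.
HB.instance Definition _ := EqQuotient.on quotient_mod.

Let pi (v : V) : quotient_mod := \pi_quotient_mod v.

Let piP u v : reflect (pi u = pi v) (u - v \in B).
Proof. by rewrite Quotient.idealrBE; apply: eqP. Qed.

Let piD u v : pi (u + v) = pi u + pi v.
Proof. exact: Quotient.pi_add. Qed.

Let piK x : pi (repr x) = x. Proof. exact: reprK. Qed.

Definition quot_scale (a : K) (x : quotient_mod) : quotient_mod :=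
  \pi_quotient_mod (a *: repr x).

Definition quot_act (s : S) (x : quotient_mod) : quotient_mod :=
  \pi_quotient_mod (act s (repr x)).

Let piZ a v : quot_scale a (pi v) = pi (a *: v).
Proof. by apply/piP; rewrite -scalerBr rpredZ //; apply/piP; rewrite piK. Qed.

Let piA s v : quot_act s (pi v) = pi (act s v).
Proof. by apply/piP; rewrite -linearB act_closed //; apply/piP; rewrite piK. Qed.

Fact quot_scalerA a b x :
  quot_scale a (quot_scale b x) = quot_scale (a * b) x.
Proof. by rewrite -[x]piK !piZ scalerA. Qed.

Fact quot_scale1r : left_id 1 quot_scale.
Proof. by move=> x; rewrite -[x]piK piZ scale1r. Qed.

Fact quot_scalerDr : right_distributive quot_scale +%R.
Proof.
by move=> a x y; rewrite -[x]piK -[y]piK -piD !piZ -piD scalerDr.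
Qed.

Fact quot_scalerDl x : {morph quot_scale^~ x : a b / a + b}.
Proof. by move=> a b; rewrite -[x]piK !piZ -piD scalerDl. Qed.

HB.instance Definition _ := GRing.Zmodule_isLmodule.Build K quotient_mod
  quot_scalerA quot_scale1r quot_scalerDr quot_scalerDl.

Fact quot_act_is_linear s : linear (quot_act s).
Proof.
move=> a x y; rewrite -[x]piK -[y]piK.
have E (z : quotient_mod) : a *: z = quot_scale a z by [].
by rewrite !E piZ -piD !piA piZ -piD linearP.
Qed.

Fact quot_actM s t x : quot_act (s * t)%g x = quot_act s (quot_act t x).
Proof. by rewrite -[x]piK !piA actM. Qed.

HB.instance Definition _ :=
  Lmodule_isKSModule.Build K S quotient_mod quot_act_is_linear quot_actM.

End QuotientModule.

Section Subquotient.
Variables (K : fieldType) (S : finSemigroupType) (V : ksModType K S).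
Variables A B : ksSubmodule V.

Definition submod_restr : {pred submod_type A} := fun x => val x \in B.

Fact submod_restr_closed : submod_closed submod_restr.
Proof.
split=> [|a x y]; first by rewrite unfold_in /submod_restr linear0 rpred0.
rewrite ![_ \in submod_restr]unfold_in /submod_restr => xB yB.
by rewrite linearP rpredD ?rpredZ.
Qed.

HB.instance Definition _ :=
  GRing.isSubmodClosed.Build K (submod_type A) submod_restr submod_restr_closed.

Fact submod_restr_act s : {in submod_restr, forall x, act s x \in submod_restr}.
Proof.
by move=> x; rewrite !unfold_in /submod_restr /=; exact: act_closed.
Qed.

HB.instance Definition _ :=
  isActClosed.Build K S (submod_type A) submod_restr submod_restr_act.

(* A / (A :&: B), that is, A / B when B is contained in A *)
Definition subquotient : ksModType K S :=
  quotient_mod (submod_restr : ksSubmodule (submod_type A)).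

End Subquotient.

Section DirectSum.
Variables (K : fieldType) (S : finSemigroupType) (I : Type).
Variable U : I -> ksModType K S.

Definition dprod_type := forall i, U i.
HB.instance Definition _ := Choice.on dprod_type.

Definition dprod_zero : dprod_type := fun=> 0.
Definition dprod_opp (f : dprod_type) : dprod_type := fun i => - f i.
Definition dprod_add (f g : dprod_type) : dprod_type := fun i => f i + g i.
Definition dprod_scale (a : K) (f : dprod_type) : dprod_type :=
  fun i => a *: f i.
Definition dprod_act (s : S) (f : dprod_type) : dprod_type :=
  fun i => act s (f i).

Fact dprod_addA : associative dprod_add.
Proof. by move=> f g h; apply: functional_extensionality_dep => i; exact: addrA. Qed.
Fact dprod_addC : commutative dprod_add.
Proof. by move=> f g; apply: functional_extensionality_dep => i; exact: addrC. Qed.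
Fact dprod_add0 : left_id dprod_zero dprod_add.
Proof. by move=> f; apply: functional_extensionality_dep => i; exact: add0r. Qed.
Fact dprod_addN : left_inverse dprod_zero dprod_opp dprod_add.
Proof. by move=> f; apply: functional_extensionality_dep => i; exact: addNr. Qed.

HB.instance Definition _ :=
  GRing.isZmodule.Build dprod_type dprod_addA dprod_addC dprod_add0 dprod_addN.

Fact dprod_scaleA a b f : dprod_scale a (dprod_scale b f) = dprod_scale (a * b) f.
Proof. by apply: functional_extensionality_dep => i; exact: scalerA. Qed.
Fact dprod_scale1 : left_id 1 dprod_scale.
Proof. by move=> f; apply: functional_extensionality_dep => i; exact: scale1r. Qed.
Fact dprod_scaleDr : right_distributive dprod_scale +%R.
Proof. by move=> a f g; apply: functional_extensionality_dep => i; exact: scalerDr. Qed.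
Fact dprod_scaleDl f : {morph dprod_scale^~ f : a b / a + b}.
Proof. by move=> a b; apply: functional_extensionality_dep => i; exact: scalerDl. Qed.

HB.instance Definition _ := GRing.Zmodule_isLmodule.Build K dprod_type
  dprod_scaleA dprod_scale1 dprod_scaleDr dprod_scaleDl.

Fact dprod_act_is_linear s : linear (dprod_act s).
Proof. by move=> a f g; apply: functional_extensionality_dep => i; exact: linearP. Qed.
Fact dprod_actM s t f : dprod_act (s * t)%g f = dprod_act s (dprod_act t f).
Proof. by apply: functional_extensionality_dep => i; exact: actM. Qed.

HB.instance Definition _ :=
  Lmodule_isKSModule.Build K S dprod_type dprod_act_is_linear dprod_actM.

Definition finsupp : {pred dprod_type} :=
  fun f => `[< finite_set [set i | f i <> 0] >].

Fact finsupp_submod_closed : submod_closed finsupp.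
Proof.
split=> [|a f g].
  apply/asboolP; apply: (sub_finite_set _ (finite_set0 I)) => i /=; exact.
move=> /asboolP fF /asboolP gF; apply/asboolP.
apply: (@sub_finite_set _ _ ([set i | f i <> 0] `|` [set i | g i <> 0])%classic);
  last by rewrite finite_setU.
move=> i /= fg_neq0; apply: contrapT => /not_orP[/contrapT fi0 /contrapT gi0].
by apply: fg_neq0; rewrite -[LHS]/(a *: f i + g i) fi0 gi0 scaler0 addr0.
Qed.

HB.instance Definition _ :=
  GRing.isSubmodClosed.Build K dprod_type finsupp finsupp_submod_closed.

Fact finsupp_act s : {in finsupp, forall f, act s f \in finsupp}.
Proof.
move=> f /asboolP fF; apply/asboolP; apply: sub_finite_set fF => i /= sfi fi0.
by apply: sfi; rewrite -[LHS]/(act s (f i)) fi0 linear0.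
Qed.

HB.instance Definition _ :=
  isActClosed.Build K S dprod_type finsupp finsupp_act.

Definition dsum : ksModType K S :=
  submod_type (finsupp : ksSubmodule dprod_type).

End DirectSum.

Section Properties.
Variables (K : fieldType) (S : finSemigroupType).
Implicit Types V W : ksModType K S.

Definition faithful V := forall s t : S, act s =1 act t :> (V -> V) -> s = t.

(* The semigroup algebra KS consists of the K-valued functions on S. *)
Definition alg_act V (a : {ffun S -> K}) (v : V) : V :=
  \sum_(s : S) a s *: act s v.

(* KS V = 0 *)
Definition zero_action V := forall (a : {ffun S -> K}) (v : V), alg_act a v = 0.

Definition simple_module V :=
  ~ zero_action V /\
  forall A : ksSubmodule V, A =i pred1 0 \/ A =i predT.

Definition null_module V :=
  (exists2 w : V, w != 0 & forall v : V, exists a : K, v = a *: w) /\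
  zero_action V.

Definition isomorphic V W :=
  exists f : {linear V -> W},
    bijective f /\ forall (s : S) (v : V), f (act s v) = act s (f v).

Definition semisimple V :=
  exists (I : Type) (U : I -> ksModType K S),
    (forall i, simple_module (U i)) /\ isomorphic V (dsum U).

(* 0 = W 0 < W 1 < ... < W n = V; the values of W beyond n are irrelevant *)
Definition composition_series V (n : nat) (W : nat -> ksSubmodule V) :=
  [/\ W 0%N =i pred1 0,
      W n =i predT
    & forall i, (i < n)%N ->
      [/\ {subset W i <= W i.+1},
          ~ W i =i W i.+1
        & forall A : ksSubmodule V,
            {subset W i <= A} -> {subset A <= W i.+1} ->
            A =i W i \/ A =i W i.+1]].

(* e matches, one to one, the family U with the non-null factors of some
   composition series, so that U lists them with multiplicity and up to
   isomorphism *)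
Definition nonnull_composition_factors V (k : nat)
    (U : 'I_k -> ksModType K S) :=
  exists (n : nat) (W : nat -> ksSubmodule V) (e : 'I_k -> 'I_n),
    [/\ composition_series n W,
        injective e,
        forall i : 'I_n,
          (exists j, e j = i) <-> ~ null_module (subquotient (W i.+1) (W i))
      & forall j, isomorphic (U j) (subquotient (W (e j).+1) (W (e j)))].

End Properties.

(* Main.v *)
Require Import Defs.
From HB Require Import structures.
From mathcomp Require Import boolp classical_sets cardinality.
From mathcomp Require Import all_boot fingroup pgroup nilpotent sylow.
From mathcomp Require Import all_algebra.

(* Write s ~ t when s and t act alike on all V_j. Let e be idempotent and let b
   in eSe satisfy b ~ e. On every composition factor of V, null ones included, b
   and e act alike, so b - e is nilpotent on V; as V is faithful, such b form a
   finite group P, and an element of P whose order is invertible in K is trivial.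
   Hence P is trivial in characteristic 0 and a p-group in characteristic p.
   Now let W be any simple module. In a minimal ideal of S not annihilating W,
   choose an idempotent e with eW <> 0; elements of eSe either annihilate W or
   are units of eSe. As P is a normal p-subgroup of the units, it acts trivially
   on eW, so ~-related elements of eSe act alike on W. Since W is simple this
   extends to S, and a faithful semisimple module gives that ~ is equality. *)

Set Implicit Arguments.
Unset Strict Implicit.
Unset Printing Implicit Defensive.

Import GRing.Theory.
Local Open Scope ring_scope.
Local Open Scope quotient_scope.

(** * Fixed vectors of unipotent maps and of p-groups *)

Lemma iter_binomial (W : zmodType) (f : {additive W -> W}) m w :
  iter m f w = \sum_(i < m.+1) iter i (fun v => f v - v) w *+ 'C(m, i).
Proof.
set N := fun v => f v - v.
have NM : {morph N : x y / x + y}.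
  by move=> x y; rewrite /N raddfD opprD addrACA.
have N0 : N 0 = 0 by rewrite /N raddf0 subr0.
elim: m => [|m IHm]; first by rewrite big_ord1.
have fE v : f v = v + N v by rewrite addrC subrK.
rewrite iterS fE {}IHm (big_morph N NM N0) [RHS]big_ord_recl.
under [in RHS]eq_bigr do rewrite lift0 binS mulrnDr.
rewrite [in RHS]big_split /= big_ord_recl.
rewrite [X in _ = (_ + (X + _))%R]big_ord_recr /= (bin_small (ltnSn m)) mulr0n addr0.
rewrite -addrA !bin0; congr (_ + (_ + _)).
by apply: eq_bigr => i _; rewrite /N raddfMn mulrnBl.
Qed.

(** Expanding [f = 1 + N] binomially, [p] kills the middle terms of [f^p w], so [iter p N w = 0];
    the last nonzero iterate of [N] at [w] is fixed by [f]. *)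
Lemma p_unipotent_fixes (W : zmodType) (f : {additive W -> W}) p
    (R : W -> Prop) (w : W) :
    prime p -> (forall v : W, v *+ p = 0) ->
    (forall v, R v -> R (f v - v)) ->
    R w -> w != 0 -> iter p f w = w ->
  exists v, [/\ v != 0, R v & f v = v].
Proof.
case: p => // p p_pr pW RN Rw w0 fw; pose N v := f v - v.
have RNi i : R (iter i N w) by elim: i => //= i; apply: RN.
have Np : iter p.+1 N w == 0.
  move/eqP: fw; rewrite iter_binomial big_ord_recl big_ord_recr /=.
  rewrite big1 => [|i _].
    by rewrite add0r bin0 /bump add1n binn !mulr1n addrC eq_sym -subr_eq subrr eq_sym.
  have /dvdnP[c ->] : (p.+1 %| 'C(p.+1, bump 0 i))%N.
    by apply: prime_dvd_bin => //; rewrite /bump /= add1n ltnS ltn_ord.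
  by rewrite mulnC mulrnA mulrnAC pW.
have exN : exists i, iter i N w == 0 by exists p.+1.
case: (ex_minnP exN) => -[|i] Ni0 imin; first by rewrite /= (negPf w0) in Ni0.
exists (iter i N w); split => //; first by apply/negP => /imin; rewrite ltnn.
by apply/eqP; rewrite -subr_eq0.
Qed.

(* A maximal subgroup Q with a nonzero fixed vector is the whole group:
   otherwise it is properly contained in its normalizer, which contains some x
   outside Q with x^p in Q; then x is unipotent on the fixed vectors of Q. *)
Lemma pgroup_fixes_vector (gT : finGroupType) (W : zmodType)
    (rho : gT -> {additive W -> W}) p (w : W) :
    prime p -> (forall v : W, v *+ p = 0) -> (p.-group [set: gT])%g ->
    (forall x y v, rho (x * y)%g v = rho x (rho y v)) ->
    w != 0 -> rho 1%g w = w ->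
  exists v, v != 0 /\ forall x, rho x v = v.
Proof.
move=> p_pr pW pG rhoM w0 w1.
pose fixes (Q : {group gT}) :=
  `[< exists v, v != 0 /\ forall x, x \in Q -> rho x v = v >].
have [|Q /maxgroupP[/asboolP[v [v0 Qv]] Qmax]] := @ex_maxgroup gT fixes.
  by exists 1%G; apply/asboolP; exists w; split=> // x /set1P->.
have [QT|QT] := eqVneq Q [set: gT]%G.
  by exists v; split=> // x; apply: Qv; rewrite QT inE.
have : Q \proper [set: gT]%G by rewrite properEneq subsetT andbT.
move/(nilpotent_proper_norm (pgroup_nil pG)); rewrite setTI.
case/properP=> _ [y yN yQ].
have exk : exists k, (y ^+ (p ^ k) \in Q)%g.
  have [k yk] := p_natP (mem_p_elt pG (in_setT y)).
  by exists k; rewrite -yk expg_order group1.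
case: (ex_minnP exk) => -[|j] yj jmin.
  by rewrite expn0 expg1 (negPf yQ) in yj.
(* By minimality of the exponent, [x] lies outside [Q] while its [p]-th power lies in [Q]. *)
pose x := (y ^+ (p ^ j))%g.
have xN : x \in ('N(Q))%g by rewrite groupX.
have xQ : x \notin Q by apply/negP => /jmin; rewrite ltnn.
have xp : (x ^+ p \in Q)%g by rewrite -expgM -expnSr.
have xiter u : (0 < p)%N -> iter p (rho x) u = rho (x ^+ p)%g u.
  elim: (p) u => // -[|n] IHn u _ //.
  by rewrite expgS rhoM -IHn.
pose R u := forall z, z \in Q -> rho z u = u.
have RN u : R u -> R (rho x u - u).
  move=> Ru z zQ; rewrite raddfB (Ru z zQ) -rhoM; congr (_ - _).
  have -> : (z * x = x * (z ^ x))%g by rewrite conjgC.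
  by rewrite rhoM Ru // memJ_norm.
have [|u [u0 Ru xu]] := p_unipotent_fixes p_pr pW RN Qv v0.
  by rewrite xiter ?prime_gt0 // Qv.
(* The stabilizer of [u] contains both [Q] and [x], against the maximality of [Q]. *)
pose St := [set z | `[< rho z u = u >]].
have gSt : group_set St.
  apply/group_setP; split=> [|a b]; rewrite !inE; first exact/asboolP/Ru.
  by move=> /asboolP au /asboolP bu; apply/asboolP; rewrite rhoM bu.
have QSt : Group gSt = Q :> {set gT}.
  apply: Qmax; last by apply/subsetP => z zQ; rewrite inE; apply/asboolP/Ru.
  by apply/asboolP; exists u; split=> // z; rewrite inE => /asboolP.
by case/negP: xQ; rewrite -QSt inE; apply/asboolP.
Qed.

(** * Local monoids and idempotents of a finite semigroup *)

Section Corner.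
Variables (S : finSemigroupType) (e : S).
Hypothesis ee : (e * e)%g = e.

(** For idempotent [e] this is the monoid [eSe], with identity [e]. *)
Definition corner := [set x : S | ((e * x)%g == x) && ((x * e)%g == x)].

Lemma cornerP x : reflect ((e * x)%g = x /\ (x * e)%g = x) (x \in corner).
Proof. by rewrite inE; apply: (iffP andP) => -[/eqP ? /eqP]. Qed.

Lemma cornerM x y : x \in corner -> y \in corner -> (x * y)%g \in corner.
Proof.
move=> /cornerP[ex xe] /cornerP[ey ye].
by apply/cornerP; rewrite mulgA ex -mulgA ye.
Qed.

Lemma corner_conj x : (e * x * e)%g \in corner.
Proof. by apply/cornerP; split; [rewrite !mulgA ee | rewrite -!mulgA ee]. Qed.

Lemma corner_idem : e \in corner.
Proof. by apply/cornerP. Qed.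

(** Left multiplication by [y] is injective on the finite corner, hence onto; so [y] has a right
    inverse, which must be [x]. *)
Lemma corner_invC x y :
  x \in corner -> y \in corner -> (x * y)%g = e -> (y * x)%g = e.
Proof.
move=> xC yC xye.
have yI : {in corner &, injective (fun z => y * z)%g}.
  move=> a b /cornerP[ea _] /cornerP[eb _] yab.
  by rewrite -ea -eb -xye -!mulgA yab.
have : e \in [set (y * z)%g | z in corner].
  suff -> : [set (y * z)%g | z in corner] = corner by exact: corner_idem.
  apply/eqP; rewrite eqEcard card_in_imset // leqnn andbT.
  by apply/subsetP => _ /imsetP[z zC ->]; apply: cornerM.
case/imsetP=> z /cornerP[ez _] yz.
by move/cornerP: xC => [_ xe]; rewrite -xe {1}yz [(x * _)%g]mulgA xye ez.
Qed.

End Corner.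

(** For [x] in a minimal subsemigroup [A], minimality gives [xA = A]; then the [z] in [A] with
    [xz = x] form a subsemigroup, equal to [A], so [xx = x]. *)
Lemma subsemigroup_idempotent (S : finSemigroupType) (T : {set S}) :
    T != set0 -> {in T &, forall x y, (x * y)%g \in T} ->
  exists2 e, e \in T & (e * e)%g = e.
Proof.
move=> T0 TM.
pose sub (A : {set S}) :=
  (A != set0) && [forall x in A, forall y in A, (x * y)%g \in A].
have subT : sub T.
  by rewrite /sub T0; apply/forall_inP => x xT; apply/forall_inP => y; apply: TM.
have [A /minsetP[/andP[/set0Pn[x xA] /forall_inP AM] Amin] AT] :=
  minset_exists subT.
have {}AM a b : a \in A -> b \in A -> (a * b)%g \in A.
  by move=> aA bA; apply: (forall_inP (AM a aA)).
have xAE : [set (x * z)%g | z in A] = A.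
  apply: Amin; last by apply/subsetP => _ /imsetP[z zA ->]; apply: AM.
  apply/andP; split; first by apply/set0Pn; exists (x * x)%g; apply: imset_f.
  apply/forall_inP => _ /imsetP[a aA ->]; apply/forall_inP => _ /imsetP[b bA ->].
  by rewrite -mulgA imset_f // AM // AM.
have [z zA xz] : exists2 z, z \in A & (x * z)%g = x.
  by move: xA; rewrite -{1}xAE => /imsetP[z zA zE]; exists z.
have stabE : [set z in A | (x * z)%g == x] = A.
  apply: Amin; last by apply/subsetP => a; rewrite inE => /andP[].
  apply/andP; split; first by apply/set0Pn; exists z; rewrite inE zA xz /=.
  apply/forall_inP => a; rewrite inE => /andP[aA /eqP xa].
  apply/forall_inP => b; rewrite inE => /andP[bA /eqP xb].
  by rewrite inE AM //= mulgA xa xb.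
exists x; first exact: (subsetP AT).
by move: xA; rewrite -{1}stabE inE => /andP[_ /eqP].
Qed.

(** * Spanning sets and the apex of a simple module *)

Section SimpleModule.
Variables (K : fieldType) (S : finSemigroupType).

Definition subspace (W : lmodType K) (P : W -> Prop) :=
  P 0 /\ forall a u v, P u -> P v -> P (a *: u + v).

Lemma actP (W : ksModType K S) s a (u v : W) :
  act s (a *: u + v) = a *: act s u + act s v.
Proof. exact: act_is_linear. Qed.

Lemma act0 (W : ksModType K S) s : act s 0 = 0 :> W.
Proof. exact: linear0. Qed.

Lemma actB (W : ksModType K S) s (u v : W) : act s (u - v) = act s u - act s v.
Proof. exact: linearB. Qed.

Definition acts0 (W : ksModType K S) (s : S) := forall v : W, act s v = 0.

Lemma zero_actionP (W : ksModType K S) :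
  zero_action W <-> forall s, acts0 W s.
Proof.
split=> [W0 s v | W0 a v]; last by apply: big1 => s _; rewrite W0 scaler0.
rewrite -[RHS](W0 [ffun u => (u == s)%:R] v) /alg_act (bigD1 s) //=.
rewrite ffunE eqxx scale1r big1 ?addr0 // => u us.
by rewrite ffunE (negPf us) scale0r.
Qed.

Variable W : ksModType K S.
Hypothesis simpleW : simple_module W.

Lemma simple_subspace (P : W -> Prop) :
    subspace P -> (forall s v, P v -> P (act s v)) ->
  (forall v, P v -> v = 0) \/ (forall v, P v).
Proof.
move=> [P0 PZ] PS.
have subP : submod_closed (fun v : W => `[< P v >]).
  split=> [|a u v]; first exact/asboolP.
  by move=> /asboolP Pu /asboolP Pv; apply/asboolP/PZ.
have actA (s : S) : {in (fun v : W => `[< P v >]),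
    forall v, act s v \in fun v : W => `[< P v >]}.
  by move=> v /asboolP Pv; apply/asboolP/PS.
pose A : ksSubmodule W := HB.pack (fun v : W => `[< P v >])
  (GRing.isSubmodClosed.Build K W _ subP) (isActClosed.Build K S W _ actA).
case: (simpleW.2 A) => AE; [left=> v Pv | right=> v].
  by apply/eqP; rewrite -[_ == _]/(v \in pred1 0) -AE; apply/asboolP.
by apply/asboolP; rewrite -[asbool _]/(v \in A) AE.
Qed.

(** The span of [Sw] is a submodule. If it were zero, [w] would lie in the submodule annihilated by
    [S], which is zero since the action on [W] is not. *)
Lemma simple_span w (P : W -> Prop) :
  w != 0 -> subspace P -> (forall s, P (act s w)) -> forall v, P v.
Proof.
move=> w0 [P0 PZ] Pw v.
pose span v := forall Q : W -> Prop,
  subspace Q -> (forall s, Q (act s w)) -> Q v.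
have [|s u su Q [Q0 QZ] Qw|span0|spanT] := @simple_subspace span.
- split=> [Q [Q0 _] // | a x y sx sy Q sQ Qw].
  by apply: sQ.2; [apply: sx | apply: sy].
- apply: (su (fun u => Q (act s u))) => [|t]; last by rewrite -actM.
  by split=> [|a x y Qx Qy]; rewrite ?act0 // actP; apply: QZ.
- have [|s u Hu t|null0|nullT] :=
      @simple_subspace (fun u => forall s, act s u = 0).
  + split=> [s|a x y x0 y0 s]; first by rewrite act0.
    by rewrite actP x0 y0 scaler0 addr0.
  + by rewrite -actM Hu.
  + have /null0 w00 : forall s, act s w = 0.
      by move=> s; apply: span0 => Q _ Qw; apply: Qw.
    by rewrite w00 eqxx in w0.
  + by case: simpleW.1; apply/zero_actionP => s u; apply: nullT.
by apply: spanT.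
Qed.

Lemma simple_ideal_span (I : {set S}) (P : W -> Prop) :
    (forall s, {in I, forall x, (s * x)%g \in I}) ->
    (exists2 x, x \in I & ~ acts0 W x) ->
    subspace P -> {in I, forall x v, P (act x v)} ->
  forall v, P v.
Proof.
move=> Il [x xI /existsNP[w /eqP xw]] sP PI v.
pose span v := forall Q : W -> Prop,
  subspace Q -> {in I, forall x v, Q (act x v)} -> Q v.
have [|s u su Q [Q0 QZ] QI|span0|spanT] := @simple_subspace span.
- split=> [Q [Q0 _] // | a y z sy sz Q sQ QI].
  by apply: sQ.2; [apply: sy | apply: sz].
- apply: (su (fun u => Q (act s u))) => [|t tI z].
    by split=> [|a y z Qy Qz]; rewrite ?act0 // actP; apply: QZ.
  by rewrite -actM; apply: QI; apply: Il.
- by rewrite (span0 (act x w)) ?eqxx // in xw => Q _; apply.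
exact: spanT.
Qed.

Lemma apex_idempotent : exists e : S,
  [/\ (e * e)%g = e, ~ acts0 W e
    & {in corner e, forall a, ~ acts0 W a ->
        exists b, [/\ b \in corner e, (a * b)%g = e & (b * a)%g = e]}].
Proof.
pose nonnull (A : {set S}) := [exists x in A, ~~ `[< acts0 W x >]].
pose ideal (I : {set S}) :=
  [forall s, forall x in I, ((s * x)%g \in I) && ((x * s)%g \in I)] && nonnull I.
have idealT : ideal [set: S].
  apply/andP; split.
    by apply/forallP => s; apply/forall_inP => x _; rewrite !inE.
  apply/exists_inP; apply: contrapT => noS; apply: simpleW.1.
  apply/zero_actionP => s; apply: contrapT => s0; apply: noS.
  by exists s; rewrite ?inE //; apply/asboolPn.
have [I /minsetP[/andP[/forallP /= IP Inn] Imin] _] := minset_exists idealT.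
have Il s x : x \in I -> (s * x)%g \in I.
  by move=> xI; case/andP: (forall_inP (IP s) x xI).
have Ir s x : x \in I -> (x * s)%g \in I.
  by move=> xI; case/andP: (forall_inP (IP s) x xI).
have Inn' : exists2 x, x \in I & ~ acts0 W x.
  by case/exists_inP: Inn => x xI /asboolPn; exists x.
pose rideal (R : {set S}) :=
  [forall x in R, forall s, (x * s)%g \in R] && nonnull R.
have ridealI : rideal I.
  by rewrite /rideal Inn andbT; apply/forall_inP=> x xI;
  apply/forallP=> s; apply: Ir.
have [R /minsetP[/andP[/forall_inP RP /exists_inP[x xR /asboolPn x0]] Rmin] _] :=
  minset_exists ridealI.
have xIE : [set (x * y)%g | y in I] = R.
  apply: Rmin; last first.
    by apply/subsetP => _ /imsetP[y _ ->]; apply: (forallP (RP x xR)).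
  apply/andP; split.
    apply/forall_inP => _ /imsetP[y yI ->]; apply/forallP => s.
    by rewrite -mulgA imset_f // Ir.
  (* If [xI] annihilated [W], so would [x], since [IW] spans [W]. *)
  apply: contrapT => xI0; apply: x0.
  apply: (@simple_ideal_span I) => // [|y yI v].
    by split=> [|a u v u0 v0]; rewrite ?act0 // actP u0 v0 scaler0 addr0.
  rewrite -actM; apply: contrapT => xyv; apply: xI0; apply/exists_inP.
  by exists (x * y)%g; [exact: imset_f | apply/asboolPn => /(_ v)].
pose stab := [set z in I | (x * z)%g == x].
have stab0 : stab != set0.
  move: xR; rewrite -xIE => /imsetP[z zI xz]; apply/set0Pn.
  by exists z; rewrite inE zI -xz eqxx.
have [|e] := subsemigroup_idempotent stab0.
  move=> a b; rewrite !inE => /andP[aI /eqP xa] /andP[_ /eqP xb].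
  by rewrite Ir // mulgA xa xb eqxx.
rewrite inE => /andP[eI /eqP xe] ee; exists e; split=> // [e0|a aC a0].
  by apply: x0 => v; rewrite -xe actM e0 act0.
have /cornerP[ea ae] := aC.
have aI : a \in I by rewrite -ea Ir.
pose J := [set (u.1 * a * u.2)%g | u : S * S].
have JE : J = I.
  apply: Imin; last by apply/subsetP => _ /imsetP[u _ ->]; apply/Ir/Il.
  apply/andP; split; last first.
    apply/exists_inP; exists a; last exact/asboolPn.
    by apply/imsetP; exists (e, e); rewrite //= ea ae.
  apply/forallP => s; apply/forall_inP => _ /imsetP[[u v] _ ->] /=.
  apply/andP; split; apply/imsetP.
    by exists ((s * u)%g, v); rewrite //= !mulgA.
  by exists (u, (v * s)%g); rewrite //= !mulgA.
move: eI; rewrite -JE => /imsetP[[u v] _ /= eE].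
have uav : ((e * u * e) * (a * (e * v * e)))%g = e.
  transitivity (e * (u * (e * a * e) * v) * e)%g; first by rewrite !mulgA.
  by rewrite ea ae -eE !ee.
have avu : ((a * (e * v * e)) * (e * u * e))%g = e.
  apply: corner_invC uav => //; first exact: corner_conj.
  by apply: cornerM => //; exact: corner_conj.
exists ((e * v * e) * (e * u * e))%g.
have bC : ((e * v * e) * (e * u * e))%g \in corner e.
  by apply: cornerM; exact: corner_conj.
have ab : (a * ((e * v * e) * (e * u * e)))%g = e by rewrite mulgA.
by split=> //; apply: corner_invC ab.
Qed.

End SimpleModule.

(** * Elements acting alike on a family of modules *)

Section SameAction.
Variables (K : fieldType) (S : finSemigroupType) (I : Type).
Variable U : I -> ksModType K S.

Definition same_action (s t : S) := forall i, act s =1 act t :> (U i -> U i).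

Lemma same_actionM s s' t t' :
  same_action s s' -> same_action t t' -> same_action (s * t)%g (s' * t')%g.
Proof. by move=> ss' tt' i v; rewrite !actM tt' ss'. Qed.

(** In the application [b - e] is nilpotent on [V], hence the name. *)
Definition unipotents (e : S) := [set b in corner e | `[< same_action b e >]].

Lemma unipotentsP e b :
  reflect (b \in corner e /\ same_action b e) (b \in unipotents e).
Proof.
rewrite [b \in unipotents e]in_set; apply: (iffP andP) => -[bC /asboolP be]; split=> //.
Qed.

(** The faithful module [V] enters through this hypothesis and the next: cancellation makes
    [unipotents e] a group, and torsion leaves it no nontrivial element of order invertible in
    [K]. *)
Hypothesis unipotent_cancel : forall e, (e * e)%g = e ->
  {in unipotents e, forall b, {in corner e &, injective (fun x => b * x)%g}}.

Hypothesis unipotent_torsion : forall e, (e * e)%g = e ->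
  {in unipotents e, forall b m, m%:R != 0 :> K ->
    iter m (fun x => b * x)%g e = e -> b = e}.

Section Idempotent.
Variable e : S.
Hypothesis ee : (e * e)%g = e.

Let P := unipotents e.

Lemma unipotents_idem : e \in P.
Proof. by apply/unipotentsP; split=> //; exact: corner_idem. Qed.

Lemma unipotentsM b c : b \in P -> c \in P -> (b * c)%g \in P.
Proof.
move=> /unipotentsP[bC be] /unipotentsP[cC ce]; apply/unipotentsP; split.
  exact: cornerM.
by rewrite -[X in same_action _ X]ee; apply: same_actionM.
Qed.

(** Left multiplication by [b] permutes the finite set [P], so [bc = e] for some [c] in [P];
    one-sided inverses in the corner are two-sided. *)
Lemma unipotents_linv b : b \in P -> exists2 c, c \in P & (c * b)%g = e.
Proof.
move=> bP; have PC x : x \in P -> x \in corner e by move=> /unipotentsP[].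
have bI : {in P &, injective (fun x => b * x)%g}.
  by move=> x y /PC xC /PC yC; exact: (unipotent_cancel ee bP).
have bPE : [set (b * x)%g | x in P] = P.
  apply/eqP; rewrite eqEcard card_in_imset // leqnn andbT.
  by apply/subsetP => _ /imsetP[x xP ->]; apply: unipotentsM.
have : e \in [set (b * x)%g | x in P] by rewrite bPE unipotents_idem.
case/imsetP=> c cP /esym bc.
by exists c => //; exact: (corner_invC ee (PC _ bP) (PC _ cP) bc).
Qed.

(** By Cauchy's theorem and the torsion hypothesis, every prime dividing the order of [P] vanishes
    in [K]. So [P] is trivial and fixes [w], or it is a p-group in characteristic p and has a
    nonzero fixed vector. *)
Lemma unipotents_fix_vector (W : ksModType K S) (w : W) :
    w != 0 -> act e w = w ->
  exists v : W, v != 0 /\ {in P, forall b, act b v = v}.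
Proof.
move=> w0 ew.
pose T := {x : S | x \in P}.
pose mkT z (zP : z \in P) : T := exist _ z zP.
pose mulT (x y : T) : T := mkT _ (unipotentsM (svalP x) (svalP y)).
pose oneT : T := mkT e unipotents_idem.
have linvT (x : T) : exists y, mulT y x = oneT.
  have [c cP cx] := unipotents_linv (svalP x).
  by exists (mkT c cP); apply: val_inj.
pose invT x := sval (cid (linvT x)).
have mulTA : associative mulT by move=> x y z; apply: val_inj; rewrite /= mulgA.
have mul1T : left_id oneT mulT.
  move=> x; apply: val_inj => /=.
  by have /unipotentsP[/cornerP[]] := svalP x.
have mulVT : left_inverse oneT invT mulT by move=> x; exact: svalP (cid (linvT x)).
pose gT : finGroupType := HB.pack T (Finite_isGroup.Build T mulTA mul1T mulVT).
have valX (x : gT) m : val (x ^+ m)%g = iter m (fun y => val x * y)%g e.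
  by elim: m => // m IHm; rewrite expgS /= -IHm.
have primeK q : prime q -> (q %| #|[set: gT]|)%N -> q%:R = 0 :> K.
  move=> q_pr /(Cauchy q_pr)[x _ xq]; apply/eqP/negP => /negP q0.
  have x1 : x = 1%g.
    apply: val_inj; apply: (unipotent_torsion ee (svalP x) q0).
    by rewrite -valX -xq expg_order.
  by move: q_pr; rewrite -xq x1 order1.
have [T1 | T1] := eqVneq #|[set: gT]| 1%N.
  exists w; split=> // b bP.
  have /set1P b1 : (mkT b bP : gT) \in [set 1%g].
    have /eqP/cards1P[x xE] := T1.
    have := in_setT (1%g : gT); rewrite xE => /set1P ->.
    by rewrite -xE inE.
  by rewrite -[b]/(val (mkT b bP : gT)) b1.
have p_pr : prime (pdiv #|[set: gT]|).
  by apply: pdiv_prime; rewrite ltn_neqAle eq_sym T1 cardG_gt0.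
set p := pdiv _ in p_pr.
have pK : p \in [pchar K] by rewrite inE p_pr primeK ?pdiv_dvd /=.
pose rho (x : gT) : {additive W -> W} := act (val x).
have [||x y v|||v [v0 vP]] := @pgroup_fixes_vector gT W rho p w p_pr.
- by move=> v; rewrite -scaler_nat (pcharf0 pK) scale0r.
- apply/pgroupP => q q_pr qT; rewrite -(pcharf_eq pK) inE q_pr.
  by rewrite primeK /=.
- by rewrite /rho /= actM.
- by [].
- by [].
exists v; split=> // b bP; exact: (vP (mkT b bP)).
Qed.

End Idempotent.

(* Unipotents of the corner form a normal p-subgroup of its group of units, so
   their fixed vectors form a submodule. *)
Lemma unipotents_act_trivially (W : ksModType K S) e : simple_module W ->
    (e * e)%g = e -> ~ acts0 W e ->
    {in corner e, forall a, ~ acts0 W a ->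
      exists b, [/\ b \in corner e, (a * b)%g = e & (b * a)%g = e]} ->
  {in unipotents e, forall b (v : W), act b (act e v) = act e v}.
Proof.
move=> simpleW ee /existsNP[w /eqP ew] unitC b bP v.
have [|v0 [v0N0 v0P]] := unipotents_fix_vector ee ew; first by rewrite -actM ee.
have ev0 : act e v0 = v0 by apply: v0P; exact: unipotents_idem.
move: v b bP; apply: (simple_span simpleW v0N0) => [|s b bP].
  split=> [b _ | a u v uP vP b bP]; first by rewrite !act0.
  by rewrite !actP uP ?vP.
have hv : act e (act s v0) = act (e * s * e)%g v0 by rewrite !actM ev0.
have hC := corner_conj ee s; rewrite hv; set h := (e * s * e)%g in hC *.
have [h0 | /(unitC h hC)[h' [h'C hh' h'h]]] := pselect (acts0 W h).
  by rewrite h0 act0.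
have /unipotentsP[bC be] := bP; have /cornerP[eb _] := bC.
have /cornerP[_ h'e] := h'C.
(* Here [h' * b * h] is the conjugate of [b] by the unit [h], hence again in [P] and fixing [v0]. *)
have -> : act b (act h v0) = act h (act (h' * b * h)%g v0).
  by rewrite -!actM !mulgA hh' eb.
rewrite v0P //; apply/unipotentsP; split; first by do 2!apply: cornerM => //.
rewrite -h'h -[X in same_action _ (X * _)%g]h'e.
by do 2![apply: same_actionM => //].
Qed.

(** If a unit [a] of the corner, with inverse [a'], acts like [b] on the family, then [a'b] is in
    [unipotents e], so [a] and [b] agree on [W]. This applies to [eusve] and [eutve] for all [u] and
    [v], which is enough: [W] is spanned by the translates of a nonzero [e w0], and only [0] is
    killed by [eS]. *)
Lemma same_action_simple (W : ksModType K S) s t : simple_module W ->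
  same_action s t -> act s =1 act t :> (W -> W).
Proof.
move=> simpleW st; have [e [ee e0 unitC]] := apex_idempotent simpleW.
have trivP := unipotents_act_trivially simpleW ee e0 unitC.
have corner_same a b : a \in corner e -> b \in corner e -> same_action a b ->
    ~ acts0 W a -> act a =1 act b :> (W -> W).
  move=> aC bC ab /(unitC a aC)[a' [a'C aa' a'a]] w.
  have /cornerP[eb be] := bC; have /cornerP[ea ae] := aC.
  have a'bP : (a' * b)%g \in unipotents e.
    apply/unipotentsP; split; first exact: cornerM.
    by rewrite -a'a; apply: same_actionM => // i v; rewrite ab.
  rewrite -{1}ae actM -(trivP _ a'bP w) -!actM; congr (act _ w).
  by rewrite !mulgA aa' eb be.
have esame u v (w : W) :
    act (e * (u * s * v) * e)%g w = act (e * (u * t * v) * e)%g w.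
  set a := (X in act X w); set b := (X in _ = act X w).
  have ab : same_action a b.
    by do 4?[apply: same_actionM => //].
  have aC : a \in corner e by exact: corner_conj.
  have bC : b \in corner e by exact: corner_conj.
  have [a0 | a0] := pselect (acts0 W a); last exact: corner_same.
  have [b0 | b0] := pselect (acts0 W b); first by rewrite a0 b0.
  by apply/esym/corner_same => // i v'; rewrite ab.
have /existsNP[w0 /eqP ew0] := e0.
have eS0 (d : W) : (forall u, act (e * u)%g d = 0) -> d = 0.
  have [||null0|all0] := @simple_subspace _ _ _ simpleW
      (fun d => forall u, act (e * u)%g d = 0).
  - split=> [u|a x y x0 y0 u]; first by rewrite act0.
    by rewrite actP x0 y0 scaler0 addr0.
  - by move=> r x x0 u; rewrite -actM -mulgA.
  - exact: null0.
  - by rewrite -ee all0 eqxx in ew0.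
move=> v; apply/eqP; rewrite -subr_eq0; apply/eqP; move: v.
apply: (simple_span simpleW ew0) => [|v].
  split=> [|a x y xst yst]; first by rewrite !act0 subrr.
  by rewrite !actP opprD addrACA -scalerBr xst yst scaler0 addr0.
apply: eS0 => u; rewrite actB -!actM.
by have := esame u v w0; rewrite !mulgA => ->; rewrite subrr.
Qed.

End SameAction.

(** * Comparing actions across isomorphisms, direct sums and quotients *)

Section Transport.
Variables (K : fieldType) (S : finSemigroupType).

Lemma isomorphic_act_eq (V W : ksModType K S) s t : isomorphic V W ->
  act s =1 act t :> (V -> V) <-> act s =1 act t :> (W -> W).
Proof.
case=> f [fB fS]; have [g fK gK] := fB; split=> st v; last first.
  by apply: (bij_inj fB); rewrite !fS st.
by rewrite -[v]gK -!fS st.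
Qed.

Lemma dsum_act_eq (I : eqType) (U : I -> ksModType K S) s t :
  act s =1 act t :> (dsum U -> dsum U) <-> same_action U s t.
Proof.
split=> [st i v | st f]; last first.
  by apply: val_inj; apply: functional_extensionality_dep => i; exact: st.
pose f : dprod_type U := dfwith (fun i => 0 : U i) v.
have fP : f \in @finsupp K S I U.
  apply/asboolP; apply: sub_finite_set (finite_set1 i) => j /= fj.
  by apply: contrapT => /eqP ji; apply: fj; rewrite /f dfwith_out // eq_sym.
have := st (SubmodType (A := @finsupp K S I U : ksSubmodule (dprod_type U)) fP).
move/(congr1 (fun g : dsum U => submod_val g i)) => /=.
by rewrite -[LHS]/(act s (f i)) -[RHS]/(act t (f i)) /f dfwith_in.
Qed.

(** The quotient action is computed on representatives; replacing [v] by the representative [r] of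
    its class alters [act s v] and [act t v] by elements of [B]. *)
Lemma quotient_act_eq (V : ksModType K S) (B : ksSubmodule V) s t :
    act s =1 act t :> (quotient_mod B -> quotient_mod B) ->
  forall v : V, act s v - act t v \in B.
Proof.
move=> st v; pose r := generic_quotient.repr (\pi_(quotient_mod B) v).
have vr : v - r \in B by rewrite Quotient.idealrBE; apply/eqP; rewrite reprK.
have /eqP := st (\pi_(quotient_mod B) v).
rewrite -[act s _]/(quot_act s _) -[act t _]/(quot_act t _) /quot_act -/r.
rewrite -Quotient.idealrBE => str.
rewrite -[v](subrK r); move: (v - r) vr => u uB.
rewrite !(raddfD (act _)) opprD addrACA.
by rewrite rpredD // rpredB ?act_closed.
Qed.

Lemma subquotient_act_eq (V : ksModType K S) (A B : ksSubmodule V) s t :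
    act s =1 act t :> (subquotient A B -> subquotient A B) ->
  {in A, forall v, act s v - act t v \in B}.
Proof.
move=> st v vA.
exact: (@quotient_act_eq _ (submod_restr B : ksSubmodule (submod_type A))
  s t st (SubmodType vA)).
Qed.

End Transport.

(** * Elements acting alike on the layers of a filtration *)

Section Filtration.
Variables (K : fieldType) (S : finSemigroupType) (V : ksModType K S).
Variables (n : nat) (W : nat -> ksSubmodule V) (b e : S).
Hypothesis W0 : W 0%N =i pred1 0.
Hypothesis WT : W n =i predT.
Hypothesis Wbe : forall i, (i < n)%N ->
  {in W i.+1, forall v, act b v - act e v \in W i}.
Hypothesis ee : (e * e)%g = e.
Hypothesis bC : b \in corner e.

(** Here [v = act e v - act b v], so [Wbe] pushes [v] down one layer at a time until it lies in
    [W 0]. *)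
Lemma filtration_cancel (v : V) : act e v = v -> act b v = 0 -> v = 0.
Proof.
move=> ev bv.
suff Wv i : (i <= n)%N -> v \in W (n - i)%N.
  by have := Wv n (leqnn n); rewrite subnn W0 => /eqP.
elim: i => [_|i IHi ltin]; first by rewrite subn0 WT.
have ltn : (n - i.+1 < n)%N by rewrite -subSn // subSS leq_subr.
have := Wbe ltn (x := v); rewrite -subSn // subSS bv ev sub0r rpredN.
by apply; apply/IHi/ltnW.
Qed.

(** Climbing the filtration on vectors [u] fixed by [e], the difference [d = bu - u] is one layer
    lower, so [b] fixes it and [b^j u = u + jd]. From [b^m = e] comes [md = 0], hence [d = 0]. *)
Lemma filtration_torsion m : m%:R != 0 :> K ->
  iter m (fun x => b * x)%g e = e -> forall v : V, act b v = act e v.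
Proof.
move=> m0 bm v; have /cornerP[eb be] := bC.
suff fixb i u : (i <= n)%N -> u \in W i -> act e u = u -> act b u = u.
  by rewrite -{1}be actM (fixb n) ?WT // -actM ee.
elim: i u => [|i IHi] u lein uW eu.
  by move: uW; rewrite W0 => /eqP ->; rewrite act0.
pose d := act b u - u.
have ed : act e d = d by rewrite actB eu -actM eb.
have bd : act b d = d.
  apply: IHi (ltnW lein) _ ed.
  by rewrite /d -[X in _ - X]eu; apply: Wbe.
have iterb j : act (iter j (fun x => b * x)%g e) u = u + d *+ j.
  elim: j => [|j IHj]; first by rewrite addr0.
  rewrite iterS actM IHj addrC -scaler_nat actP bd scaler_nat mulrSr addrC.
  by rewrite -[act b u](subrK u) -/d addrAC [RHS]addrC [d + _]addrC.
have /eqP := iterb m; rewrite bm eu addrC -subr_eq subrr eq_sym -scaler_nat.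
by rewrite scaler_eq0 (negPf m0) /= subr_eq0 => /eqP.
Qed.

End Filtration.

(** * From composition factors to a filtration, and the conclusion *)

Lemma nonnull_factors_act_eq (K : fieldType) (S : finSemigroupType)
    (V : ksModType K S) k (U : 'I_k -> ksModType K S) :
    nonnull_composition_factors V U ->
  exists n (W : nat -> ksSubmodule V),
    [/\ W 0%N =i pred1 0, W n =i predT
      & forall s t, same_action U s t -> forall i, (i < n)%N ->
          {in W i.+1, forall v, act s v - act t v \in W i}].
Proof.
case=> n [W [e [[W0 WT _] _ eP Uiso]]]; exists n, W; split=> // s t st i ltin.
apply: subquotient_act_eq; pose i' := Ordinal ltin.
(* A factor matched by [U] inherits the agreement through its isomorphism; an unmatched one is null,
   so [s] and [t] both act on it as zero. *)
have [[j ej]|null] := pselect (exists j, e j = i').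
  by have /isomorphic_act_eq := Uiso j; rewrite ej => /(_ s t)[+ _]; apply.
have /contrapT[_ zero] : ~ ~ null_module (subquotient (W i.+1) (W i)).
  by move/(eP i').
by move=> v; rewrite !((zero_actionP _).1 zero).
Qed.

Theorem proposition3p5 (K : fieldType) (S : finSemigroupType)
    (hS : exists M : ksModType K S, semisimple M /\ faithful M)
    (V : finKSModType K S) (hV : faithful V)
    (k : nat) (U : 'I_k -> ksModType K S)
    (hU : nonnull_composition_factors V U) :
  faithful (dsum U).
Proof.
move=> s t /dsum_act_eq st; have [n [W [W0 WT Wst]]] := nonnull_factors_act_eq hU.
have [M [[J [X [simpleX isoM]]] faithM]] := hS.
(* From [bx = by], the element [b] kills [xv - yv], a vector fixed by [e], which is therefore
   zero. *)
have cancelU e : (e * e)%g = e -> {in unipotents U e, forall b,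
    {in corner e &, injective (fun x => b * x)%g}}.
  move=> ee b /unipotentsP[bC be] x y /cornerP[ex _] /cornerP[ey _] bxy.
  apply: hV => v; apply/eqP; rewrite -subr_eq0; apply/eqP.
  apply: (filtration_cancel W0 WT (Wst b e be)).
    by rewrite actB -!actM ex ey.
  by rewrite actB -!actM bxy subrr.
have torsionU e : (e * e)%g = e -> {in unipotents U e, forall b m,
    m%:R != 0 :> K -> iter m (fun x => b * x)%g e = e -> b = e}.
  move=> ee b /unipotentsP[bC be] m m0 bm; apply: hV => v.
  exact: (filtration_torsion W0 WT (Wst b e be) ee bC m0 bm).
(* Up to isomorphism [M] is a direct sum of simple modules, so agreement is checked on each
   coordinate. *)
apply: faithM; apply/(isomorphic_act_eq _ _ isoM) => f; apply: val_inj.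
apply: functional_extensionality_dep => j.
exact: (same_action_simple cancelU torsionU (simpleX j) st).
Qed.
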